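(* Let $\mathbf a=[-1,-1,-1,-1,1,-1,-1,-1,1,1,-1,1,-1,1,-1,1,1,-1,-1,1,1,-1,-1,1,-1,1,-1,1,1,$ $-1,-1,1,1,1,-1,-1,-1,-1,-1,1,-1,-1,1,-1,-1,-1,1,1,1,1,-1,-1,-1,1,-1,1,1,$ $1,-1,1,1,-1,-1,-1,-1,1,1,1,1,1,1,-1,-1,1,1,1,-1,1,1,1,1,1,-1,1,-1,1,-1],$ $\mathbf b=[-1,-1,-1,-1,-1,-1,-1,-1,1,1,1,1,-1,1,1,-1,1,1,-1,1,-1,1,1,1,1,-1,-1,1,1,$ $-1,1,1,-1,1,-1,-1,1,-1,-1,1,1,1,-1,1,-1,1,1,-1,-1,1,-1,-1,1,1,1,1,1,-1,-1,$ $-1,1,1,1,-1,-1,1,-1,1,-1,-1,1,-1,1,-1,-1,-1,1,-1,-1,1,1,1,-1,1,-1,1,-1],$ $\mathbf a'=[-1,-1,-1,-1,1,-1,-1,-1,1,1,1,1,1,1,-1,1,-1,-1,-1,1,1,1,-1,1,-1,-1,-1,1,$ $1,-1,-1,1,1,1,-1,-1,-1,1,-1,-1,1,-1,1,-1,-1,1,1,1,1,1,-1,-1,1,1,1,-1,1,1,-1,$ $1,1,-1,-1,-1,-1,1,-1,1,1,-1,-1,-1,-1,1,1,1,-1,1,1,-1,1,-1,-1,1,1,1,-1],$ $\mathbf b'=[-1,1,-1,1,1,-1,-1,1,1,1,1,1,1,-1,1,-1,1,1,1,-1,-1,1,-1,1,-1,1,-1,1,-1,$ $-1,-1,1,-1,-1,-1,-1,-1,-1,-1,1,-1,1,1,1,-1,1,-1,-1,1,-1,-1,1,1,1,-1,-1,$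 $1,1,-1,-1,1,-1,1,-1,-1,1,-1,1,-1,1,-1,-1,1,-1,-1,1,-1,-1,1,1,1,1,1,1,1,1,-1].$ Then $(\mathbf a,\mathbf b)$ and $(\mathbf a',\mathbf b')$ are Legendre pairs of length $87$. Moreover both $\mathbf a$ and $\mathbf a'$ have $3$-compression $$[-3,-1,1,-1,1,-3,-3,-1,1,1,1,1,-1,1,-3,1,1,1,-1,3,3,-1,-1,1,-1,1,-1,3,1],$$ and both $\mathbf b$ and $\mathbf b'$ have $3$-compression $$[-3,-1,1,-1,1,-3,-3,1,-1,1,1,1,1,-1,3,-3,1,1,-1,-1,-1,1,1,3,1,1,-1,3,-1],$$ so that each $3$-compression has exactly seven entries of absolute value $3$. In particular, a Legendre pair of length $87$ exists.
   Context: Vectors of length $\ell$ are indexed by $\mathbb{Z}_\ell=\{0,\ldots,\ell-1\}$. For $\mathbf a\in\mathbb{R}^\ell$, the periodic autocorrelation function is $\mathrm{PAF}_{\mathbf a}(j)=\sum_{i=0}^{\ell-1}a_i a_{i-j}$ (indices mod $\ell$). A pair $(\mathbf a,\mathbf b)$ of vectors in $\{-1,1\}^\ell$ is a Legendre pair of length $\ell$ if $\mathrm{PAF}_{\mathbf a}(j)+\mathrm{PAF}_{\mathbf b}(j)=-2$ for all $j\in\mathbb{Z}_\ell\setminus\{0\}$ and $\sum_i a_i=\sum_i b_i$. For $\ell=nm$, the $m$-compression of $\mathbf a$ is the length-$n$ vector $[A_0,\ldots,A_{n-1}]$ with $A_j=\sum_{i=0}^{m-1}a_{ni+j}$; here $\ell=87$,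 $m=3$, $n=29$. *)

(* Defs.v *)
From mathcomp Require Import all_boot all_order all_algebra.
From mathcomp Require Import reals.

Set Implicit Arguments.
Unset Strict Implicit.
Unset Printing Implicit Defensive.

Import Order.TTheory GRing.Theory Num.Theory.

Local Open Scope ring_scope.

(* A vector of length l is a row 'rV[R]_l. Lengths are written l.+1 below so
   that the index type 'I_l.+1 is the group Z_(l+1): the subtraction i - j is
   then the one modulo l.+1. *)
Definition PAF (R : pzRingType) (l : nat) (a : 'rV[R]_l.+1) (j : 'I_l.+1) : R :=
  \sum_i a 0 i * a 0 (i - j).

Definition pm1_vector (R : pzRingType) (l : nat) (a : 'rV[R]_l) : Prop :=
  forall i, a 0 i = -1 \/ a 0 i = 1.

Definition legendre_pair (R : pzRingType) (l : nat) (a b : 'rV[R]_l.+1) : Prop :=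
  [/\ pm1_vector a, pm1_vector b,
      forall j : 'I_l.+1, j != 0 -> PAF a j + PAF b j = - 2
    & \sum_i a 0 i = \sum_i b 0 i].

Lemma compression_index_subproof (n m : nat) (i : 'I_m) (j : 'I_n) :
  (n * i + j < n * m)%N.
Proof.
apply: (@leq_trans (n * i + n)); first by rewrite ltn_add2l.
by rewrite -mulnSr leq_mul2l ltn_ord orbT.
Qed.

Definition compression_index (n m : nat) (i : 'I_m) (j : 'I_n) : 'I_(n * m) :=
  Ordinal (compression_index_subproof i j).

(* The m-compression of a vector of length n * m. *)
Definition compression (R : pzRingType) (n m : nat) (a : 'rV[R]_(n * m)) :
    'rV[R]_n :=
  \row_(j < n) \sum_(i < m) a 0 (compression_index i j).
Arguments compression {R} n m a.

Definition vec_a (R : pzRingType) : 'rV[R]_87 := \row_i tnth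
  [tuple -1; -1; -1; -1; 1; -1; -1; -1; 1; 1; -1; 1; -1; 1; -1; 1; 1; -1; -1;
    1; 1; -1; -1; 1; -1; 1; -1; 1; 1; -1; -1; 1; 1; 1; -1; -1; -1; -1; -1; 1;
    -1; -1; 1; -1; -1; -1; 1; 1; 1; 1; -1; -1; -1; 1; -1; 1; 1; 1; -1; 1; 1;
    -1; -1; -1; -1; 1; 1; 1; 1; 1; 1; -1; -1; 1; 1; 1; -1; 1; 1; 1; 1; 1; -1;
    1; -1; 1; -1] i.

Definition vec_b (R : pzRingType) : 'rV[R]_87 := \row_i tnth
  [tuple -1; -1; -1; -1; -1; -1; -1; -1; 1; 1; 1; 1; -1; 1; 1; -1; 1; 1; -1;
    1; -1; 1; 1; 1; 1; -1; -1; 1; 1; -1; 1; 1; -1; 1; -1; -1; 1; -1; -1; 1; 1;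
    1; -1; 1; -1; 1; 1; -1; -1; 1; -1; -1; 1; 1; 1; 1; 1; -1; -1; -1; 1; 1; 1;
    -1; -1; 1; -1; 1; -1; -1; 1; -1; 1; -1; -1; -1; 1; -1; -1; 1; 1; 1; -1; 1;
    -1; 1; -1] i.

Definition vec_a' (R : pzRingType) : 'rV[R]_87 := \row_i tnth
  [tuple -1; -1; -1; -1; 1; -1; -1; -1; 1; 1; 1; 1; 1; 1; -1; 1; -1; -1; -1;
    1; 1; 1; -1; 1; -1; -1; -1; 1; 1; -1; -1; 1; 1; 1; -1; -1; -1; 1; -1; -1;
    1; -1; 1; -1; -1; 1; 1; 1; 1; 1; -1; -1; 1; 1; 1; -1; 1; 1; -1; 1; 1; -1;
    -1; -1; -1; 1; -1; 1; 1; -1; -1; -1; -1; 1; 1; 1; -1; 1; 1; -1; 1; -1; -1;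
    1; 1; 1; -1] i.

Definition vec_b' (R : pzRingType) : 'rV[R]_87 := \row_i tnth
  [tuple -1; 1; -1; 1; 1; -1; -1; 1; 1; 1; 1; 1; 1; -1; 1; -1; 1; 1; 1; -1;
    -1; 1; -1; 1; -1; 1; -1; 1; -1; -1; -1; 1; -1; -1; -1; -1; -1; -1; -1; 1;
    -1; 1; 1; 1; -1; 1; -1; -1; 1; -1; -1; 1; 1; 1; -1; -1; 1; 1; -1; -1; 1;
    -1; 1; -1; -1; 1; -1; 1; -1; 1; -1; -1; 1; -1; -1; 1; -1; -1; 1; 1; 1; 1;
    1; 1; 1; 1; -1] i.

Definition compr_a (R : pzRingType) : 'rV[R]_29 := \row_i tnth
  [tuple -3; -1; 1; -1; 1; -3; -3; -1; 1; 1; 1; 1; -1; 1; -3; 1; 1; 1; -1; 3;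
    3; -1; -1; 1; -1; 1; -1; 3; 1] i.

Definition compr_b (R : pzRingType) : 'rV[R]_29 := \row_i tnth
  [tuple -3; -1; 1; -1; 1; -3; -3; 1; -1; 1; 1; 1; 1; -1; 3; -3; 1; 1; -1; -1;
    -1; 1; 1; 3; 1; 1; -1; 3; -1] i.

(* Main.v *)
(** The vectors are images of integer vectors under the canonical ring morphism
    from the integers, which commutes with autocorrelation and compression.
    Over the integers every claim is a finite computation on lists: the
    autocorrelation at [j] is the dot product of a list with its rotation by
    [j]. *)
Require Import Defs.
From mathcomp Require Import all_boot all_order all_algebra.
From mathcomp Require Import reals.
Import Order.TTheory GRing.Theory Num.Theory.
Local Open Scope ring_scope.

Lemma PAF_map (R S : pzRingType) (f : {rmorphism R -> S}) (l : nat)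
    (a : 'rV[R]_l.+1) (j : 'I_l.+1) : PAF (map_mx f a) j = f (PAF a j).
Proof. by rewrite rmorph_sum; apply: eq_bigr => i _; rewrite !mxE rmorphM. Qed.

(** Each condition is a ring identity between entries and the numerals 1, -1 and -2, all of which a
    ring morphism preserves. *)
Lemma legendre_pair_map (R S : pzRingType) (f : {rmorphism R -> S}) (l : nat)
    (a b : 'rV[R]_l.+1) :
  legendre_pair a b -> legendre_pair (map_mx f a) (map_mx f b).
Proof.
have pm1_map c : pm1_vector c -> pm1_vector (map_mx f c).
  by move=> c1 i; rewrite mxE; case: (c1 i) => ->;
    [left; rewrite rmorphN1 | right; rewrite rmorph1].
move=> [/pm1_map ha /pm1_map hb paf sums]; split=> //.
  by move=> j j0; rewrite !PAF_map -rmorphD paf // rmorphN rmorph_nat.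
under eq_bigr do rewrite mxE.
under [RHS]eq_bigr do rewrite mxE.
by rewrite -!rmorph_sum sums.
Qed.

Lemma compression_map (R S : pzRingType) (f : {rmorphism R -> S}) (n m : nat)
    (a : 'rV[R]_(n * m)) :
  compression n m (map_mx f a) = map_mx f (compression n m a).
Proof.
apply/rowP => j; rewrite !mxE rmorph_sum.
by apply: eq_bigr => i _; rewrite mxE.
Qed.

Lemma row_tnth_map (R S : Type) (f : R -> S) (l : nat) (t : l.-tuple R) :
  map_mx f (\row_i tnth t i) = \row_i tnth (map_tuple f t) i.
Proof. by apply/rowP => i; rewrite !mxE tnth_map. Qed.

(** Rotating right by [j] makes position [i] read position [i - j] modulo the length. Adding
    [size s - j] keeps the index a natural number and matches how subtraction is defined on
    ['I_l.+1]. *)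
Lemma nth_rotr (T : Type) (x0 : T) (s : seq T) (j i : nat) :
  (j < size s)%N -> (i < size s)%N ->
  nth x0 (rotr j s) i = nth x0 s ((i + (size s - j)) %% size s).
Proof.
move=> js is_; have jle := ltnW js.
rewrite /rotr /rot nth_cat size_drop (subKn jle).
(* For [i < j] the entry comes from the dropped end of [s], moved to the front, and the index does
   not wrap; otherwise it wraps once, to [i - j]. *)
case: ltnP => ij.
  by rewrite nth_drop addnC modn_small // addnC -ltn_subRL subKn.
rewrite nth_take; last by rewrite ltn_sub2r // (leq_ltn_trans _ is_).
rewrite -[in RHS](subnK ij) -addnA subnKC // modnDr modn_small //.
by apply: leq_ltn_trans is_; apply: leq_subr.
Qed.

Lemma PAF_tuple (R : pzRingType) (l : nat) (t : l.+1.-tuple R) (j : 'I_l.+1) :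
  PAF (\row_i tnth t i) j =
  foldr +%R 0 [seq p.1 * p.2 | p <- zip t (rotr j t)].
Proof.
rewrite foldrE big_map (big_nth (0, 0)) size_zip size_rotr minnn size_tuple.
rewrite big_mkord; apply: eq_bigr => i _.
rewrite nth_zip ?size_rotr //= nth_rotr ?size_tuple // !mxE.
(* The value of [i - j] in ['I_l.+1] reduces [l.+1 - j] before adding [i]; [modnDmr] removes this
   inner reduction. *)
by rewrite !(tnth_nth 0) /= modnDmr.
Qed.

Lemma sum_tuple (R : pzRingType) (l : nat) (t : l.-tuple R) :
  \sum_i (\row_i tnth t i) 0 i = foldr +%R 0 t.
Proof. by rewrite foldrE big_tuple; apply: eq_bigr => i _; rewrite mxE. Qed.

(** A Boolean test on lists, so that evaluation can decide it; the shifts from 1 to [(size s).-1]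
    are the nonzero residues. *)
Definition legendre_seqs (R : pzRingType) (s t : seq R) : bool :=
  [&& all [in [:: -1; 1]] s, all [in [:: -1; 1]] t,
      all (fun j => foldr +%R 0 [seq p.1 * p.2 | p <- zip s (rotr j s)] +
                    foldr +%R 0 [seq p.1 * p.2 | p <- zip t (rotr j t)] == - 2)
          (iota 1 (size s).-1)
    & foldr +%R 0 s == foldr +%R 0 t].

Lemma legendre_pair_tuple (R : pzRingType) (l : nat) (s t : l.+1.-tuple R) :
  legendre_seqs R s t ->
  legendre_pair (\row_i tnth s i) (\row_i tnth t i).
Proof.
have pm1 (u : l.+1.-tuple R) :
    all [in [:: -1; 1]] u -> pm1_vector (\row_i tnth u i).
  move=> /allP u1 i; rewrite mxE; have := u1 _ (mem_tnth i u).
  by rewrite !inE => /orP[] /eqP ->; [left | right].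
case/and4P=> /pm1 hs /pm1 ht /allP paf /eqP sums; split=> //.
  move=> j j0; rewrite !PAF_tuple; apply/eqP/paf.
  by rewrite size_tuple mem_iota lt0n j0 /= add1n.
by rewrite !sum_tuple.
Qed.

Definition seq_compression (R : pzRingType) (n m : nat) (s : seq R) : seq R :=
  [seq foldr +%R 0 [seq nth 0 s (n * i + j) | i <- iota 0 m] | j <- iota 0 n].

(** The hypothesis compares bare lists, without size proofs, so evaluation settles it on explicit
    data. *)
Lemma compression_tuple (R : pzRingType) (n m : nat) (t : (n * m).-tuple R)
    (u : n.-tuple R) :
  seq_compression R n m t = u ->
  compression n m (\row_i tnth t i) = \row_i tnth u i.
Proof.
move=> tu; apply/rowP => j; rewrite !mxE (tnth_nth 0 u) -tu.
rewrite (nth_map 0) ?size_iota // nth_iota // foldrE big_map.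
have -> : iota 0 m = index_iota 0 m by rewrite /index_iota subn0.
rewrite big_mkord.
by apply: eq_bigr => i _; rewrite mxE (tnth_nth 0).
Qed.

(** Mapping [tnth t] over the enumeration of the indices gives back [t], so counting indices amounts
    to counting entries. *)
Lemma card_tuple (T : Type) (l : nat) (P : pred T) (t : l.-tuple T) :
  #|[set j | P (tnth t j)]| = count P t.
Proof.
by rewrite cardsE cardE /enum_mem size_filter -(map_tnth_enum t) count_map
  enumT; apply: eq_count.
Qed.

Lemma row_tnth_eq (T : Type) (l : nat) (s t : l.-tuple T) :
  s = t :> seq T -> \row_i tnth s i = \row_i tnth t i.
Proof. by move=> /val_inj ->. Qed.

(* A numeral of [R] is convertible to the image of the same integer numeral. *)
Lemma vec_a_int (R : pzRingType) : vec_a R = map_mx intr (vec_a int).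
Proof. by rewrite row_tnth_map; apply: row_tnth_eq. Qed.

Lemma vec_b_int (R : pzRingType) : vec_b R = map_mx intr (vec_b int).
Proof. by rewrite row_tnth_map; apply: row_tnth_eq. Qed.

Lemma vec_a'_int (R : pzRingType) : vec_a' R = map_mx intr (vec_a' int).
Proof. by rewrite row_tnth_map; apply: row_tnth_eq. Qed.

Lemma vec_b'_int (R : pzRingType) : vec_b' R = map_mx intr (vec_b' int).
Proof. by rewrite row_tnth_map; apply: row_tnth_eq. Qed.

Lemma compr_a_int (R : pzRingType) : compr_a R = map_mx intr (compr_a int).
Proof. by rewrite row_tnth_map; apply: row_tnth_eq. Qed.

Lemma compr_b_int (R : pzRingType) : compr_b R = map_mx intr (compr_b int).
Proof. by rewrite row_tnth_map; apply: row_tnth_eq. Qed.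

Lemma legendre_ab (R : pzRingType) : legendre_pair (vec_a R) (vec_b R).
Proof.
rewrite vec_a_int vec_b_int; apply: legendre_pair_map.
by apply: legendre_pair_tuple; vm_compute.
Qed.

Lemma legendre_ab' (R : pzRingType) : legendre_pair (vec_a' R) (vec_b' R).
Proof.
rewrite vec_a'_int vec_b'_int; apply: legendre_pair_map.
by apply: legendre_pair_tuple; vm_compute.
Qed.

Lemma compression_a (R : pzRingType) : compression 29 3 (vec_a R) = compr_a R.
Proof.
(* The factors 29 and 3 are given explicitly, since the length 87 is only convertible to their
   product. *)
rewrite vec_a_int compr_a_int (compression_map _ _ _ 29 3); congr map_mx.
by apply: (compression_tuple _ 29 3); vm_compute.
Qed.

Lemma compression_a' (R : pzRingType) : compression 29 3 (vec_a' R) = compr_a R.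
Proof.
rewrite vec_a'_int compr_a_int (compression_map _ _ _ 29 3); congr map_mx.
by apply: (compression_tuple _ 29 3); vm_compute.
Qed.

Lemma compression_b (R : pzRingType) : compression 29 3 (vec_b R) = compr_b R.
Proof.
rewrite vec_b_int compr_b_int (compression_map _ _ _ 29 3); congr map_mx.
by apply: (compression_tuple _ 29 3); vm_compute.
Qed.

Lemma compression_b' (R : pzRingType) : compression 29 3 (vec_b' R) = compr_b R.
Proof.
rewrite vec_b'_int compr_b_int (compression_map _ _ _ 29 3); congr map_mx.
by apply: (compression_tuple _ 29 3); vm_compute.
Qed.

(** The map from the integers to a numeric domain is injective and commutes with absolute values, so
    the count can be made on the integer list. *)
Lemma card_norm_map_intr (R : numDomainType) (l k : nat) (t : l.-tuple int) :
  #|[set j | `|(map_mx intr (\row_i tnth t i) : 'rV[R]_l) 0 j| == k%:R]| =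
  count (fun x : int => `|x| == k%:R) t.
Proof.
rewrite -card_tuple; apply: eq_card => j; rewrite !inE !mxE.
by rewrite -intr_norm -(rmorph_nat (intr : int -> R)) eqr_int.
Qed.

Theorem mainTheorem2 (R : realType) :
  (legendre_pair (vec_a R) (vec_b R) /\ legendre_pair (vec_a' R) (vec_b' R)) /\
  (compression 29 3 (vec_a R) = compr_a R /\
   compression 29 3 (vec_a' R) = compr_a R) /\
  (compression 29 3 (vec_b R) = compr_b R /\
   compression 29 3 (vec_b' R) = compr_b R) /\
  [/\ #|[set j : 'I_29 | `|compression 29 3 (vec_a R) 0 j| == 3]| = 7%N,
      #|[set j : 'I_29 | `|compression 29 3 (vec_a' R) 0 j| == 3]| = 7%N,
      #|[set j : 'I_29 | `|compression 29 3 (vec_b R) 0 j| == 3]| = 7%N &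
      #|[set j : 'I_29 | `|compression 29 3 (vec_b' R) 0 j| == 3]| = 7%N] /\
  (exists a b : 'rV[R]_87, legendre_pair a b).
Proof.
(* Each compression is shared by two of the four vectors, so two counts give all four
   cardinalities. *)
have card_a : #|[set j | `|compr_a R 0 j| == 3]| = 7%N.
  by rewrite compr_a_int card_norm_map_intr; vm_compute.
have card_b : #|[set j | `|compr_b R 0 j| == 3]| = 7%N.
  by rewrite compr_b_int card_norm_map_intr; vm_compute.
rewrite compression_a compression_a' compression_b compression_b'.
split; first by split; [apply: legendre_ab | apply: legendre_ab'].
do !split=> //.
by exists (vec_a R), (vec_b R); apply: legendre_ab.
Qed.
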